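(* Let $A_1,\dots,A_k$ be nonempty subsets of $\mathbb R^n$ with $k\ge n+1$ such that each $\mathrm{conv}(A_i)$ is closed and pointed. Then for every $y\in\mathrm{conv}\big(\sum_{i=1}^kA_i\big)$ there exist faces $F_i$ of $\mathrm{conv}(A_i)$, $i=1,\dots,k$, such that $$y\in\sum_{i=1}^kF_i\qquad\text{and}\qquad\sum_{i=1}^k\dim(F_i)\le n.$$
   Context: Sums of sets are Minkowski sums; $\mathrm{conv}$ is the convex hull. A closed convex set is pointed if it contains no line. For a closed convex set $C$, a closed convex set $F\subseteq C$ is a face of $C$ if for every segment $[a,b]\subseteq C$ with $(a,b)\cap F\neq\emptyset$ one has $[a,b]\subseteq F$ (so $C$ is a face of itself). $\dim(F)$ is the dimension of the affine hull of $F$. *)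

(* Defs.v *)
(* R^n is 'rV[R]_n with its (product) topology; n = 0 is allowed. *)
From HB Require Import structures.
From mathcomp Require Import all_boot all_order all_algebra.
From mathcomp Require Import ring.
From mathcomp Require Import all_classical all_reals all_analysis.
Set Implicit Arguments.
Unset Strict Implicit.
Unset Printing Implicit Defensive.
Import Order.TTheory GRing.Theory Num.Theory.
Import numFieldNormedType.Exports.
Local Open Scope classical_set_scope.
Local Open Scope ring_scope.

Section convexity.
Context {R : realType} {n : nat}.
Local Notation V := 'rV[R]_n.
Implicit Types (C F S A : set V) (a b x v : V).

Definition conv_hull S : set V := smallest (@convex_set R V) S.

Definition mink_sum k (B : 'I_k -> set V) : set V :=
  [set x | exists2 z : 'I_k -> V, forall i, B i (z i) & x = \sum_(i < k) z i].

Definition line x v : set V := [set x + t *: v | t in [set: R]].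

Definition pointed_set C := forall x v, v != 0 -> ~ (line x v `<=` C).

Definition closed_segment a b : set V :=
  [set (1 - t) *: a + t *: b | t in `[0, 1]].

(* For a = b this is [set a] rather than the empty set; the notion of face
   below does not depend on that convention. *)
Definition open_segment a b : set V :=
  [set (1 - t) *: a + t *: b | t in `]0, 1[].

Definition face C F :=
  [/\ closed F, convex_set F, F `<=` C &
      forall a b, closed_segment a b `<=` C ->
        open_segment a b `&` F !=set0 -> closed_segment a b `<=` F].

Definition affine_set A :=
  forall a b (t : R), A a -> A b -> A ((1 - t) *: a + t *: b).

Definition aff_hull S : set V := smallest affine_set S.

Definition translate x (U : {vspace V}) : set V :=
  [set x + u | u in [set u | u \in U]].

(* Dimension of the direction of aff_hull S; aff_dimP and aff_dimE show that it
   is well defined. The empty set gets the junk value 0. *)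
Definition aff_dim S : nat :=
  xget 0%N [set d | exists x (U : {vspace V}),
                      aff_hull S = translate x U /\ \dim U = d].

Lemma aff_hull_affine S : affine_set (aff_hull S).
Proof. by move=> a b t Sa Sb A [/= AA SA]; apply: (AA); [exact: Sa|exact: Sb]. Qed.

Lemma translate_inj x y (U W : {vspace V}) :
  translate x U = translate y W -> U = W.
Proof.
have sub p q (X Y : {vspace V}) : translate p X = translate q Y ->
    (X <= Y)%VS.
  move=> e; have H u : u \in X -> p + u - q \in Y.
    move=> uX; have : translate p X (p + u) by exists u.
    by rewrite e => -[w /= wY <-]; rewrite addrC addKr.
  apply/subvP => u uX.
  have := memvB (H _ uX) (H _ (mem0v X)).
  by rewrite addr0 opprB addrA subrK addrC addKr.
by move=> e; apply/eqP; rewrite eqEsubv (sub _ _ _ _ e) (sub _ _ _ _ (esym e)).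
Qed.

Lemma affine_translate A x : affine_set A -> A x ->
  exists U : {vspace V}, A = translate x U.
Proof.
move=> affA Ax.
pose P d := `[< exists U : {vspace V},
  (forall u, u \in U -> A (x + u)) /\ \dim U = d >].
have exP : exists d, P d.
  exists 0%N; apply/asboolP; exists 0%VS; split; last exact: dimv0.
  by move=> u; rewrite memv0 => /eqP ->; rewrite addr0.
have bP d : P d -> (d <= \dim {:V})%N.
  by move=> /asboolP[U [_ <-]]; apply/dimvS/subvf.
case: (ex_maxnP exP bP) => d /asboolP[U [UA Ud]] dmax.
exists U; rewrite eqEsubset; split; last by move=> _ [u /= uU <-]; exact: UA.
move=> y Ay; exists (y - x); last by rewrite addrC subrK.
rewrite /=; apply: contrapT => /negP yU.
suff /dmax : P (\dim (U + <[y - x]>)%VS).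
  rewrite leqNgt -Ud => /negP; apply.
  rewrite ltn_neqAle dimvS ?addvSl// andbT.
  apply: contra yU; rewrite (dimv_leqif_eq (addvSl _ _)) => /eqP ->.
  by apply: (subvP (addvSr _ _)); exact: memv_line.
apply/asboolP; eexists; split; last reflexivity.
move=> _ /memv_addP[u uU [_ /vlineP[c ->] ->]].
have A1 : A (x + 2 *: u) by apply/UA/memvZ.
have A2 := affA _ _ (2 * c) Ax Ay.
have := affA _ _ 2^-1 A1 A2; congr A.
by apply/rowP => j; rewrite !mxE; field.
Qed.

Lemma aff_dimE S x (U : {vspace V}) :
  aff_hull S = translate x U -> aff_dim S = \dim U.
Proof.
move=> e; rewrite /aff_dim; case: xgetP => [d _ /= [y [W [e' <-]]]|/(_ (\dim U))].
  by congr (\dim _); apply: (@translate_inj y x); rewrite -e' -e.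
by case; exists x, U.
Qed.

Lemma aff_dimP S : S !=set0 ->
  exists x (U : {vspace V}), aff_hull S = translate x U /\ aff_dim S = \dim U.
Proof.
move=> [x Sx]; have Hx : aff_hull S x by move=> A [_]; exact.
have [U e] := affine_translate (aff_hull_affine (S := S)) Hx.
by exists x, U; split => //; exact: aff_dimE e.
Qed.

End convexity.

(* Main.v *)
(* The convex hull of the Minkowski sum lies in the Minkowski sum of the
   C_i = conv (A_i). At z in C_i let T_i(z) be the space of directions v for
   which both v and - v are feasible. Among the decompositions y = \sum_i z_i
   with z_i in C_i, take one minimizing \sum_i dim T_i(z_i) (in effect an extreme
   point of the fibre over y). If the sum of the T_i(z_i) were not direct, some
   nonzero family v_i in T_i(z_i) would have sum 0; as the C_i contain no line,
   moving z along v or - v leaves the product of the C_i, and at the exit point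
   the sum of dimensions is smaller. So \sum_i dim T_i(z_i) <= n, and
   F_i = C_i `&` (z_i + T_i(z_i)) is a face of C_i. *)
Require Import Defs.
From mathcomp Require Import all_boot all_order all_algebra.
From mathcomp Require Import ring lra.
From mathcomp Require Import all_classical all_reals all_analysis.
Import Order.TTheory GRing.Theory Num.Theory.
Import numFieldNormedType.Exports.
Local Open Scope classical_set_scope.
Local Open Scope ring_scope.

Section feasible_directions.
Context {R : realType} {n : nat}.
Local Notation V := 'rV[R]_n.
Implicit Types (C F : set V) (x z u v : V).

(** * Cones of feasible directions and their lineality spaces *)

Lemma convex_setP C : @convex_set R V C <->
  forall x z (t : R), 0 <= t <= 1 -> C x -> C z -> C (t *: x + (1 - t) *: z).
Proof.
split=> [cC x z t /andP[t0 t1] Cx Cz|cC x z t /set_mem Cx /set_mem Cz].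
  have t01 : Itv.spec (@Itv.num_sem R) (Itv.Real `[0%Z, 1%Z]) t.
    by rewrite /= /Itv.num_sem num_real in_itv/= t0 t1.
  by have /set_mem := cC x z (Itv.mk t01) (mem_set Cx) (mem_set Cz).
by apply/mem_set; apply: cC => //; apply/andP.
Qed.

(** The cone of positive multiples of [C - z]; no closure is taken, so a feasible direction really
    allows a step inside [C]. *)
Definition feasible C z : set V :=
  [set v | exists2 e : R, 0 < e & C (z + e *: v)].

Lemma feasible_sub C z x : C x -> feasible C z (x - z).
Proof. by exists 1 => //; rewrite scale1r addrC subrK. Qed.

Lemma feasibleZ C z (c : R) v :
  C z -> 0 <= c -> feasible C z v -> feasible C z (c *: v).
Proof.
move=> Cz; rewrite le_eqVlt => /predU1P[<- _|c0 [e e0 Ce]].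
  by exists 1 => //; rewrite scale0r scaler0 addr0.
exists (e / c); first by rewrite divr_gt0.
by rewrite scalerA divfK// gt_eqF.
Qed.

Lemma feasibleD C z u v : @convex_set R V C ->
  feasible C z u -> feasible C z v -> feasible C z (u + v).
Proof.
move=> /convex_setP cC [e e0 Ce] [f f0 Cf].
have ef0 : 0 < e + f by rewrite addr_gt0.
(* With this step length the new point is the convex combination of [z + e *: u] and [z + f *: v]
   with weights [f / (e + f)] and [e / (e + f)]. *)
exists (e * f / (e + f)); first by rewrite divr_gt0 ?mulr_gt0.
have t01 : 0 <= f / (e + f) <= 1.
  by rewrite divr_ge0 ?(ltW ef0) ?(ltW f0)//= ler_pdivrMr// mul1r lerDr ltW.
have := cC _ _ _ t01 Ce Cf; congr C.
by apply/rowP => j; rewrite !mxE; field; rewrite gt_eqF.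
Qed.

Lemma feasible_le C z v (e d : R) : @convex_set R V C -> C z ->
  0 < e -> C (z + e *: v) -> 0 <= d <= e -> C (z + d *: v).
Proof.
move=> /convex_setP cC Cz e0 Ce /andP[d0 de].
have t01 : 0 <= d / e <= 1 by rewrite divr_ge0 ?(ltW e0)//= ler_pdivrMr// mul1r.
have := cC _ _ _ t01 Ce Cz; congr C.
by apply/rowP => j; rewrite !mxE; field; rewrite gt_eqF.
Qed.

(** The lineality space of the cone [feasible C z]. That it is a subspace relies on convexity of [C]
    and on [z] lying in [C]; the value is [0] if no subspace fits. *)
Definition tangent C z : {vspace V} :=
  xget 0%VS [set U : {vspace V} |
    [set v | v \in U] = feasible C z `&` -%R @^-1` feasible C z].

Lemma tangentP C z v : @convex_set R V C -> C z ->
  v \in tangent C z <-> feasible C z v /\ feasible C z (- v).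
Proof.
move=> cC Cz; rewrite /tangent; case: xgetP => [U _ /= e|/= noU].
  by split => [vU|vF]; [have : [set v | v \in U] v by []|
    suff : [set v | v \in U] v by []]; rewrite e.
(* [L] is stable under sums and scalings, hence an affine set through [0], hence a subspace by
   [affine_translate]. *)
exfalso; pose L := feasible C z `&` -%R @^-1` feasible C z.
have LZ (c : R) u : L u -> L (c *: u).
  move=> [/= u1 u2]; have [c0|/ltW c0] := leP 0 c.
    by split; rewrite /= -?scalerN; exact: feasibleZ.
  split; rewrite /= -?scaleNr; last by apply: feasibleZ; rewrite ?oppr_ge0.
  by rewrite -[c]opprK scaleNr -scalerN; apply: feasibleZ; rewrite ?oppr_ge0.
have LD u w : L u -> L w -> L (u + w).
  by move=> [u1 u2] [w1 w2]; split; rewrite /= ?opprD; exact: feasibleD.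
have L0 : L 0 by split; rewrite /= ?oppr0; exists 1 => //; rewrite scaler0 addr0.
have [U LU] : exists U, L = translate 0 U.
  by apply: affine_translate => // a b t La Lb; apply: LD; exact: LZ.
apply: (noU U); rewrite -/L LU; apply/seteqP; split => [u uU|_ [u uU <-]] /=.
  by exists u; rewrite ?add0r.
by rewrite add0r.
Qed.

(** If [x + e *: u] is in [C], then [x - z + e *: u] is feasible at [z]; adding the feasible [z - x]
    leaves [e *: u]. *)
Lemma tangent_sub C z x : @convex_set R V C -> C z -> C x ->
  x - z \in tangent C z -> (tangent C x <= tangent C z)%VS.
Proof.
move=> cC Cz Cx /tangentP[]// _ xz; apply/subvP => v /tangentP[]// v1 v2.
have lift u : feasible C x u -> feasible C z u.
  move=> [e e0 Ce]; have := feasibleD _ _ _ _ cC (feasible_sub _ z _ Ce) xz.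
  rewrite opprB addrA subrK [x + _]addrC addrK => /(feasibleZ _ _ e^-1 _ Cz).
  by rewrite scalerA mulVf ?gt_eqF// scale1r invr_ge0 ltW//; exact.
by apply/tangentP => //; split; exact: lift.
Qed.

Lemma feasible_family k (C : 'I_k -> set V) (z v : 'I_k -> V) :
  (forall i, @convex_set R V (C i)) -> (forall i, C i (z i)) ->
  (forall i, feasible (C i) (z i) (v i)) ->
  exists2 e : R, 0 < e & forall i, C i (z i + e *: v i).
Proof.
move=> cC Cz fv; pose e i := xget (1 : R) [set e | 0 < e /\ C i (z i + e *: v i)].
have eP i : 0 < e i /\ C i (z i + e i *: v i).
  rewrite /e; case: xgetP => [? -> //|noe].
  by have [d d0 Cd] := fv i; case: (noe d).
(* By convexity steps may be shortened, so the least one serves all indices; the default [1] keeps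
   it positive when [k = 0]. *)
have d0 : 0 < \big[Num.min/1]_i e i.
  by apply: lt_bigmin => // i _; have [] := eP i.
exists (\big[Num.min/1]_i e i) => // i; have [e0 Ce] := eP i.
by apply: (feasible_le _ _ _ (e i)) => //; rewrite (ltW d0)/= bigmin_le.
Qed.

(** * Faces cut out by tangent spaces *)

Lemma closed_vspace (U : {vspace V}) : closed [set u | u \in U].
Proof.
(* [U] is the zero set of [f], whose coordinates are linear in those of [u], hence continuous. *)
pose f u := u - projv U u.
have fE u : f u = \sum_(j < n) u 0 j *: f (delta_mx 0 j).
  rewrite [u in LHS]row_sum_delta /f linear_sum -sumrB.
  by apply: eq_bigr => j _; rewrite linearZ /= scalerBr.
have -> : [set u | u \in U] = \bigcap_j [set u | f u 0 j = 0].
  apply/seteqP; split => [u /= uU j _|u fu] /=.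
    by rewrite /f projv_id// subrr mxE.
  have /eqP : f u = 0 by apply/rowP => j; rewrite fu// mxE.
  by rewrite subr_eq0 => /eqP ->; exact: memv_proj.
apply: closed_bigI => j _.
apply: (@closed_comp _ _ (fun u => f u 0 j) [set x : R | x = 0]); last first.
  exact: closed_eq.
move=> u _; move: u; rewrite /=.
have -> : (fun u => f u 0 j) =
    (fun u : V => \sum_(i < n) u 0 i * f (delta_mx 0 i) 0 j).
  by apply/funext => w; rewrite fE summxE; apply: eq_bigr => i _; rewrite mxE.
apply: continuous_big => [|i _]; first exact: add_continuous.
by move=> u; apply: continuousM; [exact: coord_continuous|exact: cst_continuous].
Qed.

(** For [C] closed and convex and [z] in [C], this is the smallest face of [C] through [z]. *)
Definition supporting_face C z : set V := C `&` [set x | x - z \in tangent C z].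

Lemma supporting_face_face C z : @convex_set R V C -> closed C -> C z ->
  face C (supporting_face C z).
Proof.
move=> cC clC Cz; have /convex_setP cC' := cC; split.
- apply: closedI => //.
  apply: (@closed_comp _ _ (fun x => x - z) [set u | u \in tangent C z]).
    by move=> x _; apply: continuousB; [by move=> ?|exact: cst_continuous].
  exact: closed_vspace.
- apply/convex_setP => a b t t01 [Ca /= az] [Cb /= bz]; split; first exact: cC'.
  rewrite /= (_ : _ - z = t *: (a - z) + (1 - t) *: (b - z)).
    by rewrite rpredD// rpredZ.
  by apply/rowP => j; rewrite !mxE; ring.
- by move=> x [].
- move=> a b abC [x [[t]]]; rewrite /= in_itv/= => /andP[t0 t1] <- {x} [Cx /= xz].
  have Ca : C a.
    apply: abC; exists 0; first by rewrite /= in_itv/= lexx ler01.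
    by rewrite subr0 scale1r scale0r addr0.
  have Cb : C b.
    apply: abC; exists 1; first by rewrite /= in_itv/= lexx ler01.
    by rewrite subrr scale1r scale0r add0r.
  have /tangentP[//|//|_ zx] := xz.
  (* (1 - s) (z - p) = (z - x) + s (q - z), with x the common point of the
     open segment and the face. *)
  have end_dir p q (s : R) : C p -> C q -> 0 < s < 1 ->
      feasible C z (- ((1 - s) *: p + s *: q - z)) -> p - z \in tangent C z.
    move=> Cp Cq /andP[s0 s1] zpq; apply/tangentP => //; split.
      exact: feasible_sub.
    have s1' : 0 < 1 - s by rewrite subr_gt0.
    have := feasibleD _ _ _ _ cC zpq
      (feasibleZ _ _ s _ Cz (ltW s0) (feasible_sub _ z _ Cq)).
    move=> /(feasibleZ _ _ (1 - s)^-1 _ Cz); rewrite invr_ge0 (ltW s1').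
    move=> /(_ isT); congr (feasible C z).
    by apply/rowP => j; rewrite !mxE; field; rewrite gt_eqF.
  have az : a - z \in tangent C z by apply: (end_dir a b t); rewrite ?t0.
  have bz : b - z \in tangent C z.
    apply: (end_dir b a (1 - t)) => //; first by apply/andP; split; lra.
    by rewrite subKr [t *: b + _]addrC.
  move=> _ [s /= s01 <-]; split; first by apply: abC; exists s.
  rewrite /= (_ : _ - z = (1 - s) *: (a - z) + s *: (b - z)).
    by rewrite rpredD// rpredZ.
  by apply/rowP => j; rewrite !mxE; ring.
Qed.

Lemma aff_dim_supporting_face C z : @convex_set R V C -> C z ->
  (aff_dim (supporting_face C z) <= \dim (tangent C z))%N.
Proof.
move=> cC Cz.
have Fz : supporting_face C z z by split; rewrite //= subrr mem0v.
have [x [U [FU ->]]] := aff_dimP (ex_intro _ z Fz).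
(* The affine set [z + tangent C z] contains the face, hence its affine hull; comparing differences
   of points gives the inclusion of directions. *)
have sub : translate x U `<=` translate z (tangent C z).
  rewrite -FU => p; apply; split => [a b t [u uT <-] [w wT <-]|q [_ qT]].
    exists ((1 - t) *: u + t *: w); first by rewrite /= rpredD// rpredZ.
    by apply/rowP => j; rewrite !mxE; ring.
  by exists (q - z) => //; rewrite addrC subrK.
have [x0 x0T zx0] : translate z (tangent C z) x.
  by apply: sub; exists 0; rewrite ?addr0//= mem0v.
apply/dimvS/subvP => u uU.
have [w wT e] : translate z (tangent C z) (x + u) by apply: sub; exists u.
suff -> : u = w - x0 by rewrite rpredB.
by apply/rowP => j; move/rowP/(_ j): e; rewrite -zx0 !mxE; lra.
Qed.

(** * Descent to a direct sum of tangent spaces *)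

Section product.
Context {k : nat} (C : 'I_k -> set V).
Hypotheses (cC : forall i, @convex_set R V (C i)) (clC : forall i, closed (C i)).

(* At the last point z + s v of the product, v is no longer a feasible
   direction, so one of the tangent spaces has shrunk. *)
Lemma tangent_descent_ray (z v : 'I_k -> V) (j : 'I_k) (t : R) :
  (forall i, C i (z i)) -> (forall i, v i \in tangent (C i) (z i)) ->
  0 < t -> ~ C j (z j + t *: v j) ->
  exists s : R, (forall i, C i (z i + s *: v i)) /\
    (\sum_i \dim (tangent (C i) (z i + s *: v i)%R) <
     \sum_i \dim (tangent (C i) (z i)))%N.
Proof.
move=> Cz vT t0 nCt.
pose S : set R := [set s | 0 <= s] `&`
  \bigcap_i (fun s => z i + s *: v i) @^-1` C i.
have S0 : S 0 by split; [exact: lexx|move=> i _; rewrite /= scale0r addr0].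
have ubS : has_ubound S.
  (* A time beyond [t] in [S] would, by convexity, put [z j + t *: v j] in [C j]. *)
  exists t => s [s0 /(_ j I) /= Cs]; rewrite leNgt; apply/negP => ts.
  apply: nCt; apply: (feasible_le _ _ _ s) => //; first exact: lt_trans ts.
  by rewrite !ltW.
have clS : closed S.
  apply: closedI; first exact: closed_ge.
  apply: closed_bigI => i _; apply: closed_comp => // s _.
  by apply: cvgD; [exact: cvg_cst|apply: cvgZ; [exact: cvg_id|exact: cvg_cst]].
have [s0 Cs] : S (sup S).
  have := closure_sup (ex_intro _ 0 S0) ubS.
  by rewrite -(proj1 (closure_id S)).
set s := sup S in s0 Cs.
have {}Cs i : C i (z i + s *: v i) by exact: Cs.
have le i : (tangent (C i) (z i + s *: v i) <= tangent (C i) (z i))%VS.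
  by apply: tangent_sub => //; rewrite addrC addKr rpredZ.
exists s; split => //; rewrite ltnNge; apply/negP => ge.
(* The tangent spaces can only shrink, so if the total dimension does not drop, none of them
   changes. Then [v] is still feasible at the exit point, and a common further step [e] contradicts
   the choice of [s]. *)
have eqT i : tangent (C i) (z i + s *: v i) = tangent (C i) (z i).
  apply/eqP; rewrite -(dimv_leqif_eq (le i)) eqn_leq dimvS//=.
  rewrite leqNgt; apply/negP => lt; move: ge; rewrite leqNgt => /negP; apply.
  rewrite (bigD1 i)//= [ltnRHS](bigD1 i)//= -addSn leq_add// leq_sum// => m _.
  exact: dimvS.
have [|e e0 Ce] := feasible_family _ C (fun i => z i + s *: v i) v cC Cs.
  by move=> i; have := vT i; rewrite -eqT => /tangentP[].
suff /(ub_le_sup ubS) : S (s + e) by rewrite gerDl leNgt e0.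
split => [|i _ /=]; first by rewrite /= addr_ge0// ltW.
by rewrite scalerDl addrA.
Qed.

Lemma tangent_descent (z v : 'I_k -> V) (j : 'I_k) :
  (forall i, pointed_set (C i)) ->
  (forall i, C i (z i)) -> (forall i, v i \in tangent (C i) (z i)) ->
  v j != 0 ->
  exists s : R, (forall i, C i (z i + s *: v i)) /\
    (\sum_i \dim (tangent (C i) (z i + s *: v i)%R) <
     \sum_i \dim (tangent (C i) (z i)))%N.
Proof.
move=> pC Cz vT vj.
have [t nCt] : exists t : R, ~ C j (z j + t *: v j).
  apply: contrapT => /forallNP Ct; apply: (pC j (z j) _ vj) => _ [t _ <-].
  exact: contrapT (Ct t).
(* The line may leave [C j] on either side; a negative exit time is treated by reversing [v]. *)
have [t0|t0|t0] := ltgtP t 0; last by move: nCt; rewrite t0 scale0r addr0.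
- have vT' i : - v i \in tangent (C i) (z i) by rewrite rpredN.
  have [||s] := tangent_descent_ray z (fun i => - v i) j (- t) Cz vT'.
  + by rewrite oppr_gt0.
  + by rewrite scalerN scaleNr opprK.
  under eq_bigr do rewrite scalerN -scaleNr.
  by move=> [Cs lt]; exists (- s); split => // i; rewrite scaleNr -scalerN.
- exact: tangent_descent_ray nCt.
Qed.

Lemma mink_sum_direct_tangent (y : V) : (forall i, pointed_set (C i)) ->
  mink_sum C y ->
  exists z : 'I_k -> V, [/\ forall i, C i (z i), y = \sum_i z i &
    directv (\sum_i tangent (C i) (z i))%VS].
Proof.
move=> pC [z0 Cz0 yz0].
pose P d := `[< exists z : 'I_k -> V, [/\ forall i, C i (z i), y = \sum_i z i &
  (\sum_i \dim (tangent (C i) (z i)) = d)%N] >].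
have exP : exists d, P d by eexists; apply/asboolP; exists z0; split.
case: (ex_minnP exP) => d /asboolP[z [Cz yz dz]] dmin.
exists z; split => //; apply/directv_sum_independent => v vT v0 j _.
apply/eqP/negP => /negP vj.
have [s [Cs]] := tangent_descent z v j pC Cz (fun i => vT i isT) vj.
rewrite ltnNge dz => /negP; apply; apply: dmin; apply/asboolP.
(* The moved family still sums to [y] because [v] sums to zero. *)
by eexists; split; [exact: Cs|rewrite big_split/= -scaler_sumr v0 scaler0 addr0|].
Qed.

End product.

(** * Convex hulls of Minkowski sums *)

Lemma conv_hull_convex (A : set V) : @convex_set R V (conv_hull A).
Proof.
apply/convex_setP => x z t t01 Ax Az B [/= cB AB].
by move/convex_setP : (cB); apply => //; [exact: Ax|exact: Az].
Qed.

(** A Minkowski sum of convex sets is convex, so the right-hand side is one of the convex sets over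
    which the hull is minimal. *)
Lemma conv_hull_mink_sum k (A : 'I_k -> set V) :
  conv_hull (mink_sum A) `<=` mink_sum (fun i => conv_hull (A i)).
Proof.
move=> y; apply; split => [|x [z Az ->]].
  apply/convex_setP => x w t t01 [a Aa ->] [b Ab ->].
  exists (fun i => t *: a i + (1 - t) *: b i).
    by move=> i; have /convex_setP := conv_hull_convex (A i); exact.
  by rewrite big_split/= !scaler_sumr.
by exists z => // i B [_]; exact.
Qed.

End feasible_directions.

Theorem lemma4 (R : realType) (n k : nat) (A : 'I_k -> set 'rV[R]_n)
    (hk : (n.+1 <= k)%N)
    (hA0 : forall i, A i !=set0)
    (hAc : forall i, closed (conv_hull (A i)))
    (hAp : forall i, pointed_set (conv_hull (A i)))
    (y : 'rV[R]_n) (hy : conv_hull (mink_sum A) y) :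
  exists F : 'I_k -> set 'rV[R]_n,
    [/\ forall i, face (conv_hull (A i)) (F i),
        mink_sum F y &
        (\sum_(i < k) aff_dim (F i) <= n)%N].
Proof.
have cA i := conv_hull_convex (A i).
have [z [Az yz dirT]] :=
  mink_sum_direct_tangent _ cA hAc _ hAp (conv_hull_mink_sum _ _ _ hy).
exists (fun i => supporting_face (conv_hull (A i)) (z i)); split.
- by move=> i; exact: supporting_face_face.
- by exists z => // i; split => //=; rewrite subrr mem0v.
have dimT : (\sum_(i < k) \dim (tangent (conv_hull (A i)) (z i)) <= n)%N.
  (* In a direct sum the dimensions add up to that of a subspace of the [n]-dimensional space. *)
  rewrite -(directvP dirT); apply: leq_trans (dimvS (subvf _)) _.
  by rewrite dimvf /dim/= mul1n.
apply: leq_trans dimT; apply: leq_sum => i _.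
exact: aff_dim_supporting_face.
Qed.
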